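(* Let $n\ge 2$ be an even integer and let $\tilde S_n$ act on $\tilde I^{\mathsf{FPF}}_n$ by conjugation, $w\cdot z = wzw^{-1}$. Then the pair $(\tilde I^{\mathsf{FPF}}_n,\hat\ell_{\mathsf{FPF}})$ is a quasiparabolic $\tilde S_n$-set (with respect to the simple generators $S=\{s_1,\dots,s_n\}$).
   Context: The affine symmetric group $\tilde S_n$ is the group of bijections $\pi:\mathbb Z\to\mathbb Z$ with $\pi(i+n)=\pi(i)+n$ for all $i\in\mathbb Z$ and $\pi(1)+\dots+\pi(n)=1+\dots+n$. For $i\in\mathbb Z$, $s_i\in\tilde S_n$ interchanges $i+kn$ and $i+1+kn$ for all $k\in\mathbb Z$ and fixes all other integers; $\tilde S_n$ is a Coxeter group with simple generators $S=\{s_1,\dots,s_n\}$ and length function $\ell$. The set of reflections $R(\tilde S_n)=\{wsw^{-1}: w\in\tilde S_n, s\in S\}$ consists of the elements $t_{ij}$ ($i<j$, $j\not\equiv i \pmod n$) exchanging $i+kn$ and $j+kn$ for all $k$ and fixing all other integers. $\tilde I^{\mathsf{FPF}}_n=\{z\in\tilde S_n: z(z(i))=i \text{ and } z(i)\neq i \text{ for all } i\in\mathbb Z\}$, and $\hat\ell_{\mathsf{FPF}}(z)=\tfrac12(\ell(z)-\tfrac n2)$. For a Coxeter system $(W,S)$ with reflections $R(W)$: a scaled $W$-set is a pair $(X,\mathrm{ht})$ where $X$ is a $W$-set and $\mathrm{ht}:X\to\mathbb Z$ satisfies $|\mathrm{ht}(sx)-\mathrm{ht}(x)|\le 1$ for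 all $s\in S$, $x\in X$. A quasiparabolic $W$-set is a scaled $W$-set such that (QP1) for all $r\in R(W)$ and $x\in X$, if $\mathrm{ht}(rx)=\mathrm{ht}(x)$ then $rx=x$; and (QP2) for all $r\in R(W)$, $x\in X$, $s\in S$, if $\mathrm{ht}(rx)>\mathrm{ht}(x)$ and $\mathrm{ht}(srx)<\mathrm{ht}(sx)$ then $rx=sx$. *)

(* Defs.v *)
From HB Require Import structures.
From mathcomp Require Import all_boot all_order all_algebra.
From mathcomp Require Import boolp classical_sets.

Set Implicit Arguments.
Unset Strict Implicit.
Unset Printing Implicit Defensive.

Import Order.TTheory GRing.Theory Num.Theory.
Local Open Scope ring_scope.

Section CoxeterNotions.
Variables (W : groupType) (S : set W).
Local Open Scope group_scope.

Definition reflections : set W :=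
  [set r | exists w s : W, S s /\ r = w * s * w^-1].

Definition is_word (w : W) (k : nat) : Prop :=
  exists t : seq W, [/\ size t = k, forall s, s \in t -> S s & \prod_(s <- t) s = w].

Lemma word_exists_asbool (w : W) :
  (exists k, is_word w k) -> exists k, `[< is_word w k >].
Proof. by case=> k wk; exists k; apply/asboolP. Qed.

(* Generators of a Coxeter group are involutions, so words need no inverses.
   The value is 0 by convention outside the subgroup generated by S. *)
Definition word_length (w : W) : nat :=
  match pselect (exists k, is_word w k) with
  | left wk => ex_minn (word_exists_asbool wk)
  | right _ => 0%N
  end.

Section ScaledSets.
Variables (X : Type) (act : W -> X -> X) (ht : X -> rat).

Definition is_group_set : Prop :=
  (forall x, act 1 x = x) /\ (forall g h x, act (g * h) x = act g (act h x)).

(* Heights are given in rat because their formulas may contain fractions; the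
   requirement that they lie in Z is part of the definition. *)
Definition scaled_set : Prop :=
  [/\ is_group_set,
      forall x, ht x \is a Num.int
    & forall s x, S s -> (`|ht (act s x) - ht x| <= 1)%R].

Definition QP1 : Prop :=
  forall r x, reflections r -> ht (act r x) = ht x -> act r x = x.

Definition QP2 : Prop :=
  forall r x s, reflections r -> S s ->
    (ht x < ht (act r x))%R ->
    (ht (act (s * r) x) < ht (act s x))%R ->
    act r x = act s x.

Definition quasiparabolic : Prop := [/\ scaled_set, QP1 & QP2].

End ScaledSets.
End CoxeterNotions.

Definition affine_perm (n : nat) (f : int -> int) : Prop :=
  [/\ bijective f,
      forall i, f (i + n%:Z) = f i + n%:Z
    & \sum_(1 <= i < n.+1) f i%:Z = \sum_(1 <= i < n.+1) i%:Z].

Record affSym (n : nat) := AffSym {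
  aff_fun :> int -> int;
  affP : affine_perm n aff_fun }.

HB.instance Definition _ n := gen_eqMixin (affSym n).
HB.instance Definition _ n := gen_choiceMixin (affSym n).

Lemma affSym_ext n (p q : affSym n) : (forall i, p i = q i) -> p = q.
Proof.
case: p q => [f Pf] [g Pg] /= /funext efg; case: _ / efg Pg => Pg.
by congr AffSym; apply: Prop_irrelevance.
Qed.

Section AffineGroup.
Variable n : nat.

Lemma periodZ (f : int -> int) :
  (forall i, f (i + n%:Z) = f i + n%:Z) ->
  forall i k, f (i + k * n%:Z) = f i + k * n%:Z.
Proof.
move=> pf i k; elim/int_rec: k i => [|k IH|k IH] i; first by rewrite mul0r !addr0.
  by rewrite intS mulrDl mul1r addrA IH pf addrA.
rewrite intS opprD mulrDl mulN1r addrA IH addrA; congr (_ + _).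
by apply: (addIr n%:Z); rewrite -pf !subrK.
Qed.

Lemma periodZ0 (h : int -> int) :
  (forall i, h (i + n%:Z) = h i) -> forall i k, h (i + k * n%:Z) = h i.
Proof.
move=> ph i k; pose f i := h i + i.
have pf j : f (j + n%:Z) = f j + n%:Z by rewrite /f ph addrA.
by have := periodZ pf i k; rewrite /f -addrA => /addIr.
Qed.

Lemma window_sum (h f : int -> int) :
  injective f -> (forall i, f (i + n%:Z) = f i + n%:Z) ->
  (forall i, h (i + n%:Z) = h i) ->
  \sum_(1 <= i < n.+1) h (f i%:Z) = \sum_(1 <= i < n.+1) h i%:Z.
Proof.
move=> injf pf ph; rewrite !big_add1 !big_mkord /=.
have [->|n0] := posnP n; first by rewrite !big_ord0.
have nz : n%:Z != 0 by rewrite eqz_nat -lt0n.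
pose a (i : 'I_n) := ((f i.+1%:Z - 1) %% n%:Z)%Z.
have a_ge0 i : 0 <= a i by exact: modz_ge0.
have ltan i : (`|a i| < n)%N.
  by rewrite -ltz_nat gez0_abs //; apply: ltz_pmod.
pose g i := Ordinal (ltan i).
have gE i : (g i).+1%:Z = f i.+1%:Z - ((f i.+1%:Z - 1) %/ n%:Z)%Z * n%:Z.
  rewrite /= -addn1 PoszD gez0_abs //; apply/(canRL (addrK _)).
  by rewrite addrAC [X in X + 1]addrC -divz_eq subrK.
have injg : injective g.
  move=> i j eg; have := gE i; rewrite eg gE.
  rewrite -!mulNr -!periodZ // => /injf e; apply/val_inj => /=.
  have : (i.+1%:Z = j.+1%:Z %[mod n%:Z])%Z.
    rewrite -[LHS](modzMDl (- ((f i.+1%:Z - 1) %/ n%:Z)%Z)) addrC -e.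
    by rewrite addrC modzMDl.
  rewrite !intS => /eqP; rewrite eqz_modDl => /eqP.
  by rewrite !modz_small ?lez_nat ?ltz_nat ?ltn_ord //= => -[].
rewrite [RHS](reindex_inj injg); apply: eq_bigr => i _.
by rewrite [in RHS]gE -mulNr periodZ0.
Qed.

Lemma affine_one : affine_perm n id.
Proof. by split=> //; exists id. Qed.

Lemma affine_mul (p q : affSym n) : affine_perm n (p \o q).
Proof.
case: p q => [f [bf pf sf]] [g [bg pg sg]]; split=> /=.
- exact: bij_comp.
- by move=> i; rewrite pg pf.
rewrite -sg; apply/eqP; rewrite -subr_eq0 -sumrB.
rewrite (@window_sum (fun i => f i - i)) ?sumrB ?sf ?subrr //; first exact: bij_inj.
by move=> i; rewrite pf opprD addrACA subrr addr0.
Qed.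

Lemma aff_inv_exists (p : affSym n) : exists q : affSym n, cancel p q /\ cancel q p.
Proof.
case: p => [f [[g fK gK] pf sf]] /=.
have pg i : g (i + n%:Z) = g i + n%:Z by rewrite -{1}[i]gK -pf fK.
suff ag : affine_perm n g by exists (AffSym ag).
split=> //; first by exists f.
apply/esym/eqP; rewrite -subr_eq0 -sumrB.
have ph i : f (i + n%:Z) - (i + n%:Z) = f i - i.
  by rewrite pf opprD addrACA subrr addr0.
have := window_sum (can_inj gK) pg ph.
rewrite [RHS]sumrB sf subrr => s0; apply/eqP; rewrite -[RHS]s0.
by apply: eq_bigr => i _; rewrite gK.
Qed.

Definition aff_one : affSym n := AffSym affine_one.
Definition aff_mul (p q : affSym n) : affSym n := AffSym (affine_mul p q).
Definition aff_inv (p : affSym n) : affSym n := projT1 (cid (aff_inv_exists p)).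

Lemma aff_funK (p : affSym n) : cancel p (aff_inv p).
Proof. by rewrite /aff_inv; case: cid => q []. Qed.
Lemma aff_invK (p : affSym n) : cancel (aff_inv p) p.
Proof. by rewrite /aff_inv; case: cid => q []. Qed.

Lemma aff_mulA : associative aff_mul.
Proof. by move=> p q r; apply: affSym_ext. Qed.
Lemma aff_mul1 : left_id aff_one aff_mul.
Proof. by move=> p; apply: affSym_ext. Qed.
Lemma aff_mulr1 : right_id aff_one aff_mul.
Proof. by move=> p; apply: affSym_ext. Qed.
Lemma aff_mulV : left_inverse aff_one aff_inv aff_mul.
Proof. by move=> p; apply: affSym_ext => i; apply: aff_funK. Qed.
Lemma aff_mulrV : right_inverse aff_one aff_inv aff_mul.
Proof. by move=> p; apply: affSym_ext => i; apply: aff_invK. Qed.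

End AffineGroup.

HB.instance Definition _ n := isGroup.Build (affSym n)
  (@aff_mulA n) (@aff_mul1 n) (@aff_mulr1 n) (@aff_mulV n) (@aff_mulrV n).

Lemma aff_mulE n (p q : affSym n) i : (p * q)%g i = p (q i).
Proof. by []. Qed.
Lemma aff_invE n (p : affSym n) : p^-1%g = aff_inv p.
Proof. by []. Qed.

Definition exchanges n (p : affSym n) (i j : int) : Prop :=
  [/\ forall k : int, p (i + k * n%:Z) = j + k * n%:Z,
      forall k : int, p (j + k * n%:Z) = i + k * n%:Z
    & forall m : int,
        (forall k : int, m <> i + k * n%:Z /\ m <> j + k * n%:Z) -> p m = m].

Definition simple_gens n : set (affSym n) :=
  [set s | exists2 i : nat, (1 <= i <= n)%N & exchanges s i%:Z (i%:Z + 1)].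

Lemma exchanges_uniq n (p q : affSym n) i j :
  exchanges p i j -> exchanges q i j -> p = q.
Proof.
move=> [p1 p2 p3] [q1 q2 q3]; apply: affSym_ext => m.
have [[k [->|->]]|H] := pselect (exists k : int, m = i + k * n%:Z \/ m = j + k * n%:Z).
- by rewrite p1 q1.
- by rewrite p2 q2.
have Hm k : m <> i + k * n%:Z /\ m <> j + k * n%:Z.
  by split=> e; apply: H; exists k; [left|right].
by rewrite p3 ?q3.
Qed.

Lemma exchanges_exists n (i j : int) :
  (i != j %[mod n%:Z])%Z -> exists p : affSym n, exchanges p i j.
Proof.
move=> nij; pose e (a b : int) := (a == b %[mod n%:Z])%Z.
have eM a b k : e (a + k * n%:Z) b = e a b by rewrite /e addrC modzMDl.
have eS a b : e (a + n%:Z) b = e a b by rewrite -(eM a b 1) mul1r.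
have eP a b : reflect (exists k, a = b + k * n%:Z) (e a b).
  apply: (iffP idP) => [|[k ->]]; last by rewrite eM /e.
  by rewrite /e eqz_mod_dvd => /dvdzP[k h]; exists k; rewrite -h addrC subrK.
pose f m := if e m i then m + (j - i) else if e m j then m + (i - j) else m.
have fi k : f (i + k * n%:Z) = j + k * n%:Z.
  by rewrite /f eM /e eqxx addrC addrA subrK.
have eji : e j i = false by rewrite /e eq_sym; apply/negbTE.
have fj k : f (j + k * n%:Z) = i + k * n%:Z.
  by rewrite /f !eM eji /e eqxx addrC addrA subrK.
have fm m : ~~ e m i -> ~~ e m j -> f m = m by rewrite /f => /negbTE-> /negbTE->.
have fK : involutive f.
  move=> m; case: (boolP (e m i)) => [/eP[k ->]|h1]; first by rewrite fi fj.
  case: (boolP (e m j)) => [/eP[k ->]|h2]; first by rewrite fj fi.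
  by rewrite !fm.
have cnt a : \sum_(1 <= m < n.+1) (e m%:Z a : nat)%:Z
           = \sum_(1 <= m < n.+1) (e m%:Z 0 : nat)%:Z.
  rewrite -(@window_sum n (fun m => (e m a : nat)%:Z) (fun m => m + a)).
  - apply: eq_bigr => m _; congr (nat_of_bool _)%:Z.
    by rewrite /e -[X in (_ == X %[mod _])%Z]add0r eqz_modDr.
  - exact: addIr.
  - by move=> m; rewrite addrAC.
  - by move=> m; rewrite eS.
have af : affine_perm n f.
  split; first by exists f.
    by move=> m; rewrite /f !eS; do 2?case: ifP => _ //; rewrite addrAC.
  apply/eqP; rewrite -subr_eq0 -sumrB.
  have -> : \sum_(1 <= m < n.+1) (f m%:Z - m%:Z) =
     \sum_(1 <= m < n.+1) ((e m%:Z i : nat)%:Z * (j - i) + (e m%:Z j : nat)%:Z * (i - j)).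
    apply: eq_bigr => m _; rewrite /f; case: (boolP (e m%:Z i)) => [h|_].
      have -> : e m%:Z j = false by move/eP: h => [k ->]; rewrite eM; apply/negbTE.
      by rewrite mul1r mul0r addr0 addrAC subrr add0r.
    case: ifP => _; first by rewrite mul0r mul1r add0r addrAC subrr add0r.
    by rewrite subrr !mul0r addr0.
  by rewrite big_split /= -!mulr_suml !cnt -mulrDr addrA subrK subrr mulr0.
exists (AffSym af); split=> //= m H; apply: fm; apply/negP => /eP[k];
  by have [] := H k.
Qed.

Definition fpf_involution n (z : affSym n) : Prop :=
  forall i : int, z (z i) = i /\ z i <> i.

Record fpfInv (n : nat) := FpfInv {
  fpf_val :> affSym n;
  fpfP : fpf_involution fpf_val }.

Lemma fpf_conj_subproof n (w : affSym n) (z : fpfInv n) :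
  fpf_involution (w * z * w^-1)%g.
Proof.
move=> i; rewrite !aff_mulE aff_invE aff_funK; case: (fpfP z (aff_inv w i)) => -> h.
by split=> [|e]; [exact: aff_invK | apply: h; rewrite -[in RHS]e aff_funK].
Qed.

Definition fpf_conj n (w : affSym n) (z : fpfInv n) : fpfInv n :=
  FpfInv (fpf_conj_subproof w z).

Definition fpf_height n (z : fpfInv n) : rat :=
  ((word_length (@simple_gens n) z)%:R - n%:R / 2%:R) / 2%:R.

(* Main.v *)
(** A letter of a word which reverses the order of the images of [i < j] is
    conjugate to the reflection [r = t_ij]; this is the strong exchange property,
    so [len (w r) < len w] iff [w i > w j], and no formula for the length in terms
    of inversions is needed.

    Let [z] be a fixed-point-free involution with [z i <> j]. If [z i] is not
    congruent to [j], then [r z r] is longer or shorter than [z] according as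
    [z i < z j] or [z i > z j] (multiply by [r] first on the right, then on the
    left). If [z i = j + k n], the sign of [k] decides. In particular the height
    never stays the same, which is QP1. In QP2 conjugation by [s] preserves [k], so
    the second case is impossible; in the first case [s] must reverse the order of
    [z i] and [z j], so [s = t_(z i)(z j) = z r z], which commutes with [r], and
    [r z r = s z s] follows.

    Heights are integral because [len] has the parity of the permutation induced
    on the residues modulo [n], and [z] induces a product of [n / 2] disjoint
    transpositions. *)

From mathcomp Require Import all_boot all_order all_algebra all_fingroup.
From mathcomp Require Import boolp classical_sets zify ring lra.
Require Import Defs.

Set Implicit Arguments.
Unset Strict Implicit.
Unset Printing Implicit Defensive.

Import Order.TTheory GRing.Theory Num.Theory.
Local Open Scope ring_scope.

(** * Affine permutations and congruence modulo [n] *)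

Section Congruence.
Variable n : nat.

Lemma congP (a b : int) :
  reflect (exists k, a = b + k * n%:Z) (a == b %[mod n%:Z])%Z.
Proof.
rewrite eqz_mod_dvd; apply: (iffP dvdzP) => -[k h]; exists k.
  by rewrite -h addrC subrK.
by rewrite h addrC addKr.
Qed.

Lemma aff_shift (w : affSym n) i k : w (i + k * n%:Z) = w i + k * n%:Z.
Proof. by case: (affP w) => _ h _; apply: periodZ. Qed.

Lemma aff_inj (w : affSym n) : injective w.
Proof. exact: can_inj (aff_funK w). Qed.

Lemma aff_cong (w : affSym n) i j :
  (w i == w j %[mod n%:Z])%Z = (i == j %[mod n%:Z])%Z.
Proof.
apply/congP/congP => -[k e]; exists k; last by rewrite e aff_shift.
by apply: (@aff_inj w); rewrite e aff_shift.
Qed.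

End Congruence.

(** * The involutions [t_ij] and their conjugates *)

Section Exchanges.
Variables (n : nat) (r : affSym n) (i j : int).
Hypothesis rij : exchanges r i j.

Lemma exchangesl : r i = j.
Proof. by case: rij => /(_ 0) + _ _; rewrite !mul0r !addr0. Qed.

Lemma exchangesr : r j = i.
Proof. by case: rij => _ /(_ 0) + _; rewrite !mul0r !addr0. Qed.

Lemma exchanges_sym : exchanges r j i.
Proof.
by case: rij => h1 h2 h3; split=> // m h; apply: h3 => k; have [] := h k.
Qed.

Lemma exchanges_fix m :
  (m != i %[mod n%:Z])%Z -> (m != j %[mod n%:Z])%Z -> r m = m.
Proof.
case: rij => _ _ h mi mj; apply: h => k.
by split=> e; [move/negP: mi | move/negP: mj]; apply; apply/congP; exists k.
Qed.

Lemma exchangesK m : r (r m) = m.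
Proof.
have [/congP[k ->]|mi] := boolP (m == i %[mod n%:Z])%Z.
  by rewrite !aff_shift exchangesl exchangesr.
have [/congP[k ->]|mj] := boolP (m == j %[mod n%:Z])%Z.
  by rewrite !aff_shift exchangesr exchangesl.
by rewrite !exchanges_fix.
Qed.

Lemma exchanges_mulK : (r * r = 1)%g.
Proof. exact/affSym_ext/exchangesK. Qed.

Lemma exchanges_inv : (r^-1 = r)%g.
Proof. by rewrite -[LHS]mul1g -exchanges_mulK mulgK. Qed.

Lemma exchanges_conj (w : affSym n) : exchanges (w * r * w^-1)%g (w i) (w j).
Proof.
have e m : (w * r * w^-1)%g (w m) = w (r m) by rewrite !aff_mulE aff_funK.
have [h1 h2 h3] := rij; split=> [k|k|m h].
- by rewrite -!aff_shift e h1.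
- by rewrite -!aff_shift e h2.
rewrite -[m](aff_invK w) e h3 // => k.
have [a b] := h k; split=> c; [apply: a | apply: b].
  by rewrite -[m](aff_invK w) c aff_shift.
by rewrite -[m](aff_invK w) c aff_shift.
Qed.

Lemma exchanges_shift k : exchanges r (i + k * n%:Z) (j + k * n%:Z).
Proof.
have [h1 h2 h3] := rij; split=> [l|l|m h].
- by rewrite -!addrA -mulrDl h1.
- by rewrite -!addrA -mulrDl h2.
by apply: h3 => l; have := h (l - k); rewrite -!addrA -mulrDl [k + _]addrC subrK.
Qed.

End Exchanges.

(** * Length as the minimal size of a word *)

Section Words.
Variables (W : groupType) (S : set W).
Local Open Scope group_scope.

Lemma word_length_le (t : seq W) (w : W) :
  (forall s, s \in t -> S s) -> \prod_(s <- t) s = w ->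
  (word_length S w <= size t)%N.
Proof.
move=> tS tw; rewrite /word_length; case: pselect => [wk|[]]; last first.
  by exists (size t), t.
by case: ex_minnP => m _; apply; apply/asboolP; exists t.
Qed.

Lemma word_lengthP (w : W) : (exists k, is_word S w k) ->
  exists t : seq W, [/\ size t = word_length S w,
    forall s, s \in t -> S s & \prod_(s <- t) s = w].
Proof.
move=> ew; rewrite /word_length; case: pselect => // wk.
by case: ex_minnP => m /asboolP.
Qed.

End Words.

(** * Generation by [S], strong exchange, and the effect of a reflection on length *)

Section Length.
Variable n : nat.
Hypothesis n_gt1 : (1 < n)%N.

Notation gens := (@simple_gens n).
Notation len := (word_length gens).

Lemma succ_ncong (i : int) : (i != i + 1 %[mod n%:Z])%Z.
Proof.
rewrite eqz_mod_dvd opprD addrA subrr add0r dvdzE /= dvdn1.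
by rewrite neq_ltn n_gt1 orbT.
Qed.

Lemma gen_exchanges s : gens s -> exists i, exchanges s i (i + 1).
Proof. by case=> i _ h; exists i%:Z. Qed.

Lemma exchanges_gen s (i : int) : exchanges s i (i + 1) -> gens s.
Proof.
move=> h.
have n0 : n%:Z != 0 by lia.
have m0 := modz_ge0 (i - 1) n0.
have mn : ((i - 1) %% n%:Z)%Z < n%:Z by apply: ltz_pmod; lia.
have dE := divz_eq (i - 1) n%:Z.
set k := ((i - 1) %/ n%:Z)%Z in dE; set m := ((i - 1) %% n%:Z)%Z in m0 mn dE.
(* Reducing [i - 1] and adding one back gives the representative of [i] in [1..n] rather than in
   [0..n-1]. *)
exists (`|m|.+1)%N; first by lia.
have -> : (`|m|.+1)%N%:Z = i + - k * n%:Z.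
  rewrite mulNr; move: dE; set kn := k * n%:Z; lia.
by have := exchanges_shift h (- k); rewrite addrAC.
Qed.

(* A simple generator moves every integer by at most one, so it reverses only
   the order of two adjacent integers which it exchanges. *)
Lemma gen_reverses s (a b : int) :
  gens s -> a < b -> s b < s a -> exchanges s a b /\ b = a + 1.
Proof.
move=> /gen_exchanges[i si] ab.
have mv m : [\/ s m = m, s m = m + 1 /\ (m == i %[mod n%:Z])%Z | s m = m - 1].
  have [mi|mi] := boolP (m == i %[mod n%:Z])%Z.
    case/congP: (mi) => k e; constructor 2; split=> //.
    by rewrite {1}e aff_shift (exchangesl si) e addrAC.
  have [/congP[k ->]|mj] := boolP (m == i + 1 %[mod n%:Z])%Z.
    by constructor 3; rewrite aff_shift (exchangesr si) addrAC addrK.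
  by constructor 1; apply: (exchanges_fix si).
move=> lt_s.
have [sa ai] : s a = a + 1 /\ (a == i %[mod n%:Z])%Z.
  by case: (mv a) (mv b) => [?|[] //|?] [?|[? ?]|?]; lia.
have ba : b = a + 1 by case: (mv b) => [?|[? ?]|?]; lia.
split=> //; case/congP: ai ba => k -> ->.
by rewrite addrAC; apply: exchanges_shift.
Qed.

(** A termination measure for sorting: a nonnegative integer that drops whenever a descent is
    removed. *)
Definition displacement (w : affSym n) : int :=
  \sum_(1 <= m < n.+1) (w m%:Z - m%:Z) ^+ 2.

Lemma displacement_ge0 w : 0 <= displacement w.
Proof. by apply: sumr_ge0 => m _; apply: sqr_ge0. Qed.

Lemma displacement_descent (w s : affSym n) (i : nat) :
  (1 <= i <= n)%N -> exchanges s i%:Z (i%:Z + 1) ->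
  w (i%:Z + 1) < w i%:Z -> displacement (w * s)%g < displacement w.
Proof.
move=> i_in si lt_w.
have s_shift m : s (m + n%:Z) = s m + n%:Z by rewrite -(mul1r n%:Z) aff_shift.
have w_shift m : w (m + n%:Z) = w m + n%:Z by rewrite -(mul1r n%:Z) aff_shift.
pose h (m : int) := (w m - s m) ^+ 2.
pose g (m : int) := (w m - m) ^+ 2.
have hs : displacement (w * s)%g = \sum_(1 <= m < n.+1) h m%:Z.
  rewrite -(@window_sum n h s) //; last 2 first.
  - exact: aff_inj.
  - by move=> m; rewrite /h w_shift s_shift opprD addrACA subrr addr0.
  by apply: eq_bigr => m _; rewrite /h aff_mulE (exchangesK si).
have gs : displacement w = \sum_(1 <= m < n.+1) g (s m%:Z).
  rewrite (@window_sum n g s) //; first exact: aff_inj.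
  by move=> m; rewrite /g w_shift opprD addrACA subrr addr0.
(* Rearrangement inequality: each displacement is written in two ways, directly and reindexed along
   [s], and [e m] is the termwise difference of the doubled sums. It is never positive, and it is
   negative at [m = i]. *)
pose e (m : int) := (w m - w (s m)) * (m - s m) *+ 2.
have e_le0 m : e m <= 0.
  have [/congP[k ->]|mi] := boolP (m == i%:Z %[mod n%:Z])%Z.
    rewrite /e (aff_shift s) (exchangesl si) !aff_shift; nia.
  have [/congP[k ->]|mj] := boolP (m == i%:Z + 1 %[mod n%:Z])%Z.
    rewrite /e (aff_shift s) (exchangesr si) !aff_shift; nia.
  by rewrite /e (exchanges_fix si) // subrr mul0r.
have : \sum_(1 <= m < n.+1) e m%:Z < 0.
  rewrite (bigD1_seq i) ?iota_uniq ?mem_index_iota //=.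
  have ei : e i%:Z < 0 by rewrite /e (exchangesl si); nia.
  by rewrite -[ltRHS]addr0; apply: ltr_leD ei _; apply: sumr_le0.
have -> : \sum_(1 <= m < n.+1) e m%:Z =
    displacement (w * s)%g *+ 2 - displacement w *+ 2.
  rewrite !mulr2n {1}hs {1}gs /displacement -!big_split -sumrB /=.
  apply: eq_bigr => m _; rewrite /e /h /g ?aff_mulE; ring.
lia.
Qed.

(** Without descents [w] is increasing on all of Z by periodicity. Since it gains only [n] over [n]
    steps, every step is 1 and [w] is a translation. *)
Lemma no_descent_one (w : affSym n) :
  (forall i : nat, (1 <= i <= n)%N -> w i%:Z < w (i%:Z + 1)) -> w = 1%g.
Proof.
move=> inc.
have n0 : n%:Z != 0 by lia.
have {}inc m : w m < w (m + 1).
  have m0 := modz_ge0 (m - 1) n0.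
  have mn : ((m - 1) %% n%:Z)%Z < n%:Z by apply: ltz_pmod; lia.
  have dE := divz_eq (m - 1) n%:Z.
  set k := ((m - 1) %/ n%:Z)%Z in dE; set q := ((m - 1) %% n%:Z)%Z in m0 mn dE.
  have -> : m = (`|q|.+1)%N%:Z + k * n%:Z.
    move: dE; set kn := k * n%:Z; lia.
  rewrite addrAC !aff_shift.
  by rewrite ltrD2r; apply: inc; lia.
have incn m (d : nat) : w m + d%:Z <= w (m + d%:Z).
  elim: d => [|d IH]; first by rewrite !addr0.
  rewrite -addn1 PoszD !addrA.
  by rewrite lezD1 (le_lt_trans IH) // inc.
have step m : w (m + 1) = w m + 1.
  have := incn (m + 1) (n - 1)%N; have := inc m.
  have -> : m + 1 + (n - 1)%N%:Z = m + 1 * n%:Z by lia.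
  rewrite aff_shift; move: (w m) (w (m + 1)) => a b; lia.
have lin (d : nat) : w d%:Z = w 0 + d%:Z.
  elim: d => [|d IH]; first by rewrite addr0.
  by rewrite -addn1 PoszD step IH addrA.
(* The condition on the window sum excludes nontrivial translations. *)
have w0 : w 0 = 0.
  have [_ _] := affP w.
  under eq_bigr do rewrite lin.
  rewrite big_split /= sumr_const_nat subn1 /= -[RHS]add0r => /addIr.
  move/eqP; rewrite -mulr_natr mulf_eq0 => /orP[/eqP //|].
  by rewrite natz (negbTE n0).
apply: affSym_ext => m; rewrite (divz_eq m n%:Z) addrC aff_shift.
by rewrite -(gez0_abs (modz_ge0 m n0)) lin w0 add0r.
Qed.

(** Sorting: as long as [w] has a descent, right multiplication by the corresponding generator
    lowers the displacement. *)
Lemma gens_generate (w : affSym n) : exists k, is_word gens w k.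
Proof.
have [b] := ubnP `|displacement w|; elim: b w => // b IH w lt_b.
have [/no_descent_one ->|] :=
    pselect (forall i : nat, (1 <= i <= n)%N -> w i%:Z < w (i%:Z + 1)).
  by exists 0, [::]; split; rewrite ?big_nil.
move=> /existsNP[i] /not_implyP[i_in] /negP; rewrite -leNgt => le_w.
have [s si] := exchanges_exists (succ_ncong i%:Z).
have lt_w : w (i%:Z + 1) < w i%:Z.
  rewrite lt_neqAle le_w andbT; apply/eqP => /aff_inj; lia.
have := displacement_descent i_in si lt_w.
have := displacement_ge0 (w * s)%g => d0 dlt.
have [|k [t [_ tS tw]]] := IH (w * s)%g; first by lia.
exists (size (rcons t s)), (rcons t s); split=> // [u|].
  rewrite mem_rcons inE => /predU1P[->|/tS //].
  exact: exchanges_gen si.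
by rewrite -cats1 big_cat big_seq1 /= tw -mulgA (exchanges_mulK si) mulg1.
Qed.

Lemma reduced_word (w : affSym n) : exists t : seq (affSym n),
  [/\ size t = len w, forall s, s \in t -> gens s & \prod_(s <- t) s = w]%g.
Proof. exact/word_lengthP/gens_generate. Qed.

Lemma len_mulr_gen w s : gens s -> (len (w * s)%g <= len w + 1)%N.
Proof.
move=> gs; have [t [<- tS tw]] := reduced_word w.
rewrite addn1 -(size_rcons t s); apply: word_length_le.
  by move=> u; rewrite mem_rcons inE => /predU1P[->|/tS].
by rewrite -cats1 big_cat big_seq1 /= tw.
Qed.

(** Generators are involutions, so a reversed word spells the inverse. *)
Lemma len_inv_le w : (len w^-1%g <= len w)%N.
Proof.
have [t [<- tS <-]] := reduced_word w.
rewrite -(size_rev t); apply: word_length_le => [u|].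
  by rewrite mem_rev => /tS.
elim: t tS => [|s t IH] tS; first by rewrite !big_nil invg1.
rewrite rev_cons -cats1 big_cat big_seq1 /= big_cons invMg IH => [|u ut].
  have [i si] : exists i, exchanges s i (i + 1).
    by apply/gen_exchanges/tS; rewrite mem_head.
  by rewrite (exchanges_inv si).
by apply: tS; rewrite inE ut orbT.
Qed.

Lemma len_inv w : len w^-1%g = len w.
Proof. by apply/eqP; rewrite eqn_leq len_inv_le -{1}[w]invgK len_inv_le. Qed.

Lemma len_conj_gen w s : gens s ->
  (len (s * w * s)%g <= len w + 2)%N.
Proof.
move=> gs; have [i si] := gen_exchanges gs.
have e : len (s * w)%g = len (w^-1 * s)%g.
  by rewrite -len_inv invMg (exchanges_inv si).
apply: leq_trans (len_mulr_gen _ gs) _.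
by rewrite e -(addn1 1) addnA leq_add2r -(len_inv w) len_mulr_gen.
Qed.

(* The strong exchange property: some letter of the word reverses the image of
   the pair, hence is the conjugate of r by the letters to its right. *)
Lemma strong_exchange (t : seq (affSym n)) (r : affSym n) i j :
  (forall s, s \in t -> gens s) -> exchanges r i j -> i < j ->
  (\prod_(s <- t) s)%g j < (\prod_(s <- t) s)%g i ->
  exists u, [/\ (size u < size t)%N, forall s, s \in u -> gens s
    & \prod_(s <- u) s = \prod_(s <- t) s * r]%g.
Proof.
move=> + rij ij; elim: t => [|s t IH] tS.
  by rewrite big_nil => h; have := lt_trans ij h; rewrite ltxx.
rewrite big_cons; set v := (\prod_(x <- t) x)%g in IH * => lt_sv.
have gs : gens s by apply: tS; rewrite mem_head.
have {}tS u : u \in t -> gens u by move=> ut; apply: tS; rewrite inE ut orbT.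
have [lt_v|le_v] := ltP (v j) (v i).
  have [u [su uS uE]] := IH tS lt_v.
  exists (s :: u); split=> // [x|]; last by rewrite big_cons uE mulgA.
  by rewrite inE => /predU1P[->|/uS].
have lt_v : v i < v j.
  rewrite lt_neqAle le_v andbT; apply/eqP => /aff_inj e.
  by rewrite e ltxx in ij.
have [sv _] := gen_reverses gs lt_v lt_sv.
exists t; split=> //.
have -> : s = (v * r * v^-1)%g by apply: exchanges_uniq sv (exchanges_conj rij v).
by rewrite mulgKV -mulgA (exchanges_mulK rij) mulg1.
Qed.

Lemma len_mulr_lt (w r : affSym n) i j :
  exchanges r i j -> i < j -> w j < w i -> (len (w * r)%g < len w)%N.
Proof.
move=> rij ij lt_w; have [t [<- tS tw]] := reduced_word w.
have [|u [su uS uE]] := strong_exchange tS rij ij; first by rewrite tw.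
by apply: leq_ltn_trans su; apply: word_length_le; rewrite // uE tw.
Qed.

(** In [w r] the images of [i] and [j] are swapped, so the decreasing case applies to [w r], and
    [w r r = w]. *)
Lemma len_mulr_gt (w r : affSym n) i j :
  exchanges r i j -> i < j -> w i < w j -> (len w < len (w * r)%g)%N.
Proof.
move=> rij ij lt_w; rewrite -{1}[w]mulg1 -(exchanges_mulK rij) mulgA.
apply: (len_mulr_lt rij ij).
by rewrite !aff_mulE (exchangesl rij) (exchangesr rij).
Qed.

End Length.

(** * Length of a fixed-point-free involution under conjugation by a reflection *)

Section Involutions.
Variable n : nat.
Hypothesis n_gt1 : (1 < n)%N.

Notation gens := (@simple_gens n).
Notation len := (word_length gens).

(** If [z i = i + k n], then [z (z i) = i + 2 k n]; this forces [k = 0], a fixed point. *)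
Lemma fpf_ncong (z : affSym n) i :
  fpf_involution z -> (z i != i %[mod n%:Z])%Z.
Proof.
move=> hz; apply/negP => /congP[k e].
have [zz zi] := hz i; have n0 : n%:Z != 0 by lia.
move: zz; rewrite e aff_shift e -addrA -mulrDl => /eqP.
rewrite -[eqbRHS]addr0 (inj_eq (addrI i)) mulf_eq0 (negbTE n0) orbF => k0.
by apply: zi; rewrite e (_ : k = 0) ?mul0r ?addr0 //; lia.
Qed.

Lemma invol_inv (z : affSym n) : (forall i, z (z i) = i) -> (z^-1 = z)%g.
Proof.
move=> zz; apply: (mulgI z); rewrite mulgV.
by apply: affSym_ext => i; rewrite aff_mulE zz.
Qed.

Lemma len_conj_apart (z r : affSym n) i j :
  fpf_involution z -> exchanges r i j -> i < j ->
  (z i != j %[mod n%:Z])%Z -> z i < z j ->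
  (len z < len (r * z * r)%g)%N.
Proof.
move=> hz rij ij zij lt_z; have zz k : z (z k) = k by case: (hz k).
apply: (ltn_trans (len_mulr_gt n_gt1 rij ij lt_z)).
(* Inversion replaces [z r] by [r z], so the second factor is also multiplied on the right. As [r]
   fixes [z i] and [z j], the comparison is again [z i < z j]. *)
rewrite -(len_inv n_gt1) invMg (exchanges_inv rij) (invol_inv zz).
apply: (len_mulr_gt n_gt1 rij ij); rewrite !aff_mulE.
have zji : (z j != i %[mod n%:Z])%Z by rewrite -(aff_cong z) zz eq_sym.
by rewrite !(exchanges_fix rij) // fpf_ncong.
Qed.

(* On the classes of i and j the group is infinite dihedral. With
   l = floor ((j - i) / n), the conjugate r z r is obtained from z by right
   multiplication by the reflection exchanging i and j + l n and then by the
   one exchanging i and j + (l - 2 k) n, both of which increase the length. *)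
Lemma len_conj_linked (z r : affSym n) i j :
  fpf_involution z -> exchanges r i j -> i < j ->
  (i != j %[mod n%:Z])%Z -> (z i == j %[mod n%:Z])%Z -> z i < j ->
  (len z < len (r * z * r)%g)%N.
Proof.
move=> hz rij ij nij /congP[k zi] lt_zi; have zz m : z (z m) = m by case: (hz m).
have n0 : n%:Z != 0 by lia.
have other_end (p : affSym n) (m : int) :
    exchanges p i (j + m * n%:Z) -> p j = i + - m * n%:Z.
  by move=> /exchangesr <-; rewrite -aff_shift -addrA -mulrDl subrr mul0r addr0.
have zj : z j = i + - k * n%:Z.
  by rewrite -[i in RHS]zz zi -aff_shift -addrA -mulrDl subrr mul0r addr0.
have k_lt0 : k < 0 by move: lt_zi; rewrite zi; nia.
pose d := j - i; pose l := (d %/ n%:Z)%Z; pose l' := l - k *+ 2.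
have [d_gt d_lt] : l * n%:Z < d /\ d < l * n%:Z + n%:Z.
  have d0 : (d %% n%:Z)%Z != 0.
    apply: contraNneq nij => /dvdz_mod0P; rewrite /d -eqz_mod_dvd.
    by rewrite eq_sym.
  have := divz_eq d n%:Z; have := modz_ge0 d n0; rewrite -/l => dge dE.
  have : (d %% n%:Z)%Z < n%:Z by apply: ltz_pmod; lia.
  by move: (l * _) (d %% _)%Z dE d0 dge => a b ->; lia.
have l_ge0 : 0 <= l by move: ij d_lt; rewrite /d; nia.
have nijl m : (i != j + m * n%:Z %[mod n%:Z])%Z by rewrite [j + _]addrC modzMDl.
have [p ip] := exchanges_exists (nijl l).
have [p' ip'] := exchanges_exists (nijl l').
have -> : (r * z * r = z * p * p')%g.
  apply: affSym_ext => m; rewrite !aff_mulE.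
  have [/congP[a ->]|mi] := boolP (m == i %[mod n%:Z])%Z.
    rewrite !aff_shift; congr (_ + _).
    rewrite (exchangesl rij) zj (exchangesl ip') !aff_shift (exchangesl rij).
    by rewrite (other_end _ _ ip) !aff_shift zi /l'; ring.
  have [/congP[a ->]|mj] := boolP (m == j %[mod n%:Z])%Z.
    rewrite !aff_shift; congr (_ + _).
    rewrite (exchangesr rij) zi (other_end _ _ ip') !aff_shift (exchangesr rij).
    by rewrite (exchangesl ip) !aff_shift zj /l'; ring.
  have zmi : (z m != i %[mod n%:Z])%Z.
    rewrite -(aff_cong z) zz zi; apply: contraNN mj => /eqP ->.
    by rewrite [j + _]addrC modzMDl.
  have zmj : (z m != j %[mod n%:Z])%Z.
    rewrite -(aff_cong z) zz zj; apply: contraNN mi => /eqP ->.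
    by rewrite [i + _]addrC modzMDl.
  have njl b q : (q != j %[mod n%:Z])%Z -> (q != j + b * n%:Z %[mod n%:Z])%Z.
    by rewrite [j + _]addrC modzMDl.
  rewrite (exchanges_fix rij mi mj) (exchanges_fix rij zmi zmj).
  by rewrite (exchanges_fix ip' mi (njl _ _ mj)) (exchanges_fix ip mi (njl _ _ mj)).
(* The comparison of images amounts to [d < (l - 2 k) n] for [p], where [k < 0], and to [l n < d]
   for [p']. *)
apply: (@ltn_trans (len (z * p)%g)).
  apply: (len_mulr_gt n_gt1 ip); first by move: l_ge0 ij; nia.
  by rewrite aff_shift zi zj; move: d_lt; rewrite /d; nia.
apply: (len_mulr_gt n_gt1 ip'); first by move: l_ge0 ij; rewrite /l'; nia.
rewrite !aff_mulE (exchangesl ip) !aff_shift zj (other_end _ _ ip) aff_shift zi.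
by move: d_gt; rewrite /d /l'; nia.
Qed.

(** For [z i = j + k n] the test must be [k < 0], that is [z i < j]; comparing [z i] with [z j]
    would instead test [j - i < - 2 k n]. *)
Definition conj_raises (z : affSym n) (i j : int) : bool :=
  if (z i == j %[mod n%:Z])%Z then z i < j else z i < z j.

Lemma len_conj_gt (z r : affSym n) i j :
  fpf_involution z -> exchanges r i j -> i < j -> (i != j %[mod n%:Z])%Z ->
  conj_raises z i j -> (len z < len (r * z * r)%g)%N.
Proof.
move=> hz rij ij nij; rewrite /conj_raises; case: ifPn => [|zij] lt_z.
  exact: (len_conj_linked hz rij).
exact: len_conj_apart hz rij _ _ _.
Qed.

(** Passing from [z] to [r z r] flips the test: [k] becomes [- k], nonzero because [z i != j], or
    else [z i] and [z j] change places. The increasing case then applies to [r z r]. *)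
Lemma len_conj_lt (z r : affSym n) i j :
  fpf_involution z -> exchanges r i j -> i < j -> (i != j %[mod n%:Z])%Z ->
  z i != j -> ~~ conj_raises z i j -> (len (r * z * r)%g < len z)%N.
Proof.
move=> hz rij ij nij zij ncr; have zz m : z (z m) = m by case: (hz m).
pose z' : fpfInv n := FpfInv (fpf_conj_subproof r (FpfInv hz)).
have z'E m : (r * z * r)%g m = r (z (r m)) by [].
have hz' : fpf_involution (r * z * r)%g.
  by have := fpfP z'; rewrite /= (exchanges_inv rij).
have {2}-> : z = (r * (r * z * r) * r)%g.
  by rewrite !mulgA (exchanges_mulK rij) mul1g -mulgA (exchanges_mulK rij) mulg1.
apply: (len_conj_gt hz' rij ij nij); move: ncr.
rewrite /conj_raises !z'E (exchangesl rij) (exchangesr rij).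
have [/congP[k zi]|nzij] := boolP (z i == j %[mod n%:Z])%Z.
  have zj : z j = i + - k * n%:Z.
    by rewrite -[i]zz zi -aff_shift -addrA -mulrDl subrr mul0r addr0.
  rewrite zj zi aff_shift (exchangesl rij) [j + - _ * _]addrC modzMDl eqxx.
  by move: zij; rewrite zi; lia.
have zji : (z j != i %[mod n%:Z])%Z by rewrite -(aff_cong z) zz eq_sym.
rewrite !(exchanges_fix rij) ?fpf_ncong // -leNgt (negbTE (fpf_ncong _ hz)).
rewrite le_eqVlt => /predU1P[/aff_inj e|//].
by rewrite e ltxx in ij.
Qed.

End Involutions.

(** * Parity of the length via permutations of the residues *)

Lemma card_porbits_fpf_involution (T : finType) (s : {perm T}) :
  (forall x, s (s x) = x) -> (forall x, s x != x) ->
  #|T| = #|porbits s|.*2.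
Proof.
move=> ss sx.
have porbit2 y : #|porbit s y| = 2%N.
  rewrite (_ : porbit s y = [set y; s y]%SET) ?cards2 1?eq_sym ?sx //.
  apply/setP => x; rewrite !inE; apply/porbitP/orP => [[k ->]|[/eqP->|/eqP->]].
  - elim: k => [|k IH]; first by rewrite expg0 perm1 eqxx; left.
    rewrite expgSr permM; case: IH => /eqP ->; first by right.
    by rewrite ss; left.
  - by exists 0%N; rewrite perm1.
  by exists 1%N.
(* Count [T] orbit by orbit; each orbit contributes two. *)
rewrite -muln2 -sum_nat_const -sum1_card.
rewrite (partition_big (porbit s) (mem (porbits s))) /= => [|x _]; last first.
  exact: imset_f.
apply: eq_bigr => _ /imsetP[y _ ->]; rewrite -(porbit2 y) -sum1_card.
by apply: eq_bigl => x; rewrite eq_porbit_mem.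
Qed.

Section Parity.
Variable n : nat.
Hypothesis n_gt1 : (1 < n)%N.

Lemma residue_subproof (m : int) : (`|(m %% n%:Z)%Z| < n)%N.
Proof.
by rewrite -ltz_nat gez0_abs; [apply: ltz_pmod; lia | apply: modz_ge0; lia].
Qed.

Definition residue (m : int) : 'I_n := Ordinal (residue_subproof m).

Lemma residueE m : (residue m : nat)%:Z = (m %% n%:Z)%Z.
Proof. by rewrite /= gez0_abs //; apply: modz_ge0; lia. Qed.

Lemma residue_eq a b : (residue a == residue b) = (a == b %[mod n%:Z])%Z.
Proof. by rewrite -val_eqE -eqz_nat !residueE. Qed.

Lemma residueK (i : 'I_n) : residue (i : nat)%:Z = i.
Proof. by apply/val_inj; rewrite /= modz_small ?ltz_nat /=. Qed.

Lemma residue_aff (w : affSym n) m :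
  residue (w (residue m : nat)%:Z) = residue (w m).
Proof. by apply/eqP; rewrite residue_eq aff_cong residueE modz_mod. Qed.

Lemma residue_perm_subproof (w : affSym n) :
  injective (fun i : 'I_n => residue (w (i : nat)%:Z)).
Proof.
move=> i j /eqP; rewrite residue_eq aff_cong -residue_eq !residueK.
exact: eqP.
Qed.

Definition residue_perm (w : affSym n) : {perm 'I_n} :=
  perm (@residue_perm_subproof w).

Lemma residue_permE w m : residue_perm w (residue m) = residue (w m).
Proof. by rewrite permE residue_aff. Qed.

(** The factors change places because products in [{perm 'I_n}] apply the left factor first, while
    those in [affSym n] apply the right one first. *)
Lemma residue_permM v w :
  residue_perm (v * w)%g = (residue_perm w * residue_perm v)%g.
Proof.
apply/permP => i; rewrite -[i]residueK permM !residue_permE.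
by rewrite aff_mulE.
Qed.

Lemma residue_perm_exchanges (r : affSym n) i j :
  exchanges r i j -> residue_perm r = tperm (residue i) (residue j).
Proof.
move=> rij; apply/permP => x; rewrite -[x]residueK residue_permE.
case: tpermP => [/eqP|/eqP|/eqP xi /eqP xj].
- rewrite residue_eq => /congP[k ->]; rewrite aff_shift (exchangesl rij).
  by apply/eqP; rewrite residue_eq addrC modzMDl.
- rewrite residue_eq => /congP[k ->]; rewrite aff_shift (exchangesr rij).
  by apply/eqP; rewrite residue_eq addrC modzMDl.
by rewrite residue_eq in xi; rewrite residue_eq in xj; rewrite (exchanges_fix rij).
Qed.

(** Every generator induces a transposition of residues, hence an odd permutation. *)
Lemma odd_len w : odd (word_length (@simple_gens n) w) = residue_perm w.
Proof.
have [t [<- tS <-]] := reduced_word n_gt1 w.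
elim: t tS => [|s t IH] tS.
  rewrite big_nil (_ : residue_perm 1%g = 1%g) ?odd_perm1 //.
  by apply/permP => i; rewrite -[i]residueK residue_permE perm1.
rewrite big_cons residue_permM odd_permM /= IH => [|u ut]; last first.
  by apply: tS; rewrite inE ut orbT.
have [|i si] := @gen_exchanges n s; first by apply: tS; rewrite mem_head.
rewrite (residue_perm_exchanges si) odd_tperm residue_eq.
by rewrite (succ_ncong n_gt1) addbT.
Qed.

(** The sign is the parity of [n] plus the number of cycles, and here there are [n / 2] cycles of
    size two. *)
Lemma odd_len_fpf (z : affSym n) : ~~ odd n -> fpf_involution z ->
  odd (word_length (@simple_gens n) z) = odd n./2.
Proof.
move=> n_even hz; rewrite odd_len /odd_perm card_ord (negbTE n_even) /=.
congr odd; apply: double_inj; rewrite even_halfK // -[RHS]card_ord.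
apply/esym/card_porbits_fpf_involution => i; rewrite -[i]residueK !residue_permE.
  by case: (hz (i : nat)%:Z) => ->.
by rewrite residue_eq fpf_ncong.
Qed.

End Parity.

(** * Reflections, heights and the quasiparabolic axioms *)

Lemma reflection_exchanges n (r : affSym n) : (1 < n)%N ->
  reflections (@simple_gens n) r ->
  exists i j, [/\ exchanges r i j, i < j & (i != j %[mod n%:Z])%Z].
Proof.
move=> n_gt1 [w [s [/gen_exchanges[i si] ->]]].
have wsw := exchanges_conj si w.
have nw : (w i != w (i + 1) %[mod n%:Z])%Z by rewrite aff_cong succ_ncong.
have [lt_w|lt_w|e] := ltgtP (w i) (w (i + 1)).
- by exists (w i), (w (i + 1)).
- by exists (w (i + 1)), (w i); split=> //; [apply: exchanges_sym | rewrite eq_sym].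
by rewrite e eqxx in nw.
Qed.

Lemma fpfInv_ext n (x y : fpfInv n) : fpf_val x = fpf_val y -> x = y.
Proof.
case: x y => [x hx] [y hy] /= e; case: _ / e in hy *.
by congr FpfInv; apply: Prop_irrelevance.
Qed.

Section Heights.
Variable n : nat.
Hypotheses (n_gt1 : (1 < n)%N) (n_even : ~~ odd n).

Notation gens := (@simple_gens n).
Notation len := (word_length gens).

Lemma fpf_height_int (z : fpfInv n) : fpf_height z \is a Num.int.
Proof.
have parity : odd (len z) = odd n./2 by apply: odd_len_fpf => //; apply: fpfP.
(* [len z] and [n / 2] have the same parity, so their remainders modulo 2 cancel. *)
have -> : fpf_height z = ((len z)./2%:Z - n./2./2%:Z)%:~R.
  have nE : n%:R = (n./2.*2)%:R :> rat by rewrite even_halfK.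
  rewrite /fpf_height nE -[in LHS](odd_double_half (len z)) parity.
  rewrite -[in (_./2.*2)%:R](odd_double_half n./2).
  by rewrite -!muln2 !natrM !natrD !natrM rmorphB /=; field.
exact: intr_int.
Qed.

Lemma fpf_height_lt (x y : fpfInv n) :
  (fpf_height x < fpf_height y) = (len x < len y)%N.
Proof. by rewrite /fpf_height ltr_pM2r // ltrD2r ltr_nat. Qed.

Lemma fpf_conjE w i j (z : fpfInv n) : exchanges w i j ->
  fpf_val (fpf_conj w z) = (w * z * w)%g.
Proof. by move=> wij; rewrite /= (exchanges_inv wij). Qed.

Lemma fpf_conj1 (x : fpfInv n) : fpf_conj 1%g x = x.
Proof. by apply: fpfInv_ext; rewrite /= mul1g invg1 mulg1. Qed.

Lemma fpf_conjM g h (x : fpfInv n) :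
  fpf_conj (g * h)%g x = fpf_conj g (fpf_conj h x).
Proof. by apply: fpfInv_ext; rewrite /= invMg !mulgA. Qed.

Lemma fpf_height_conj_gen s (x : fpfInv n) : gens s ->
  `|fpf_height (fpf_conj s x) - fpf_height x| <= 1.
Proof.
move=> gs; have [i si] := gen_exchanges gs.
rewrite /fpf_height (fpf_conjE x si).
have le1 := len_conj_gen n_gt1 x gs.
(* The same bound for the conjugate, whose conjugate is [x], gives the other side of the absolute
   value. *)
have le2 := len_conj_gen n_gt1 (s * x * s)%g gs.
rewrite !mulgA (exchanges_mulK si) mul1g -mulgA (exchanges_mulK si) mulg1 in le2.
move: le1 le2; set a := len _; set b := len _.
rewrite -!(ler_nat rat) !natrD => le1 le2.
rewrite ler_norml; apply/andP; split; lra.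
Qed.

(** Conjugation by [z] sends [t_ij] to [t_ji], so [z] and [r] commute. *)
Lemma fpf_conj_fixed (z : fpfInv n) r i j :
  exchanges r i j -> z i = j -> fpf_conj r z = z.
Proof.
move=> rij zi; apply: fpfInv_ext => /=.
have zz : forall m, z (z m) = m by move=> m; case: (fpfP z m).
have zrz := exchanges_conj rij z; rewrite -[in z j]zi zz zi in zrz.
have e : (fpf_val z * r * (fpf_val z)^-1)%g = r := exchanges_uniq (exchanges_sym zrz) rij.
rewrite (exchanges_inv rij) -[in X in (X * _ * _)%g]e mulgKV.
by rewrite -mulgA (exchanges_mulK rij) mulg1.
Qed.

Lemma fpf_height_conj (z : fpfInv n) r i j :
  exchanges r i j -> i < j -> (i != j %[mod n%:Z])%Z -> z i != j ->
  (fpf_height z < fpf_height (fpf_conj r z)) = conj_raises z i j /\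
  (fpf_height (fpf_conj r z) < fpf_height z) = ~~ conj_raises z i j.
Proof.
move=> rij ij nij zij; have hz := fpfP z.
rewrite !fpf_height_lt (fpf_conjE z rij).
have [up|down] := boolP (conj_raises z i j).
  have lt_len := len_conj_gt n_gt1 hz rij ij nij up.
  by rewrite lt_len ltnNge ltnW.
have lt_len := len_conj_lt n_gt1 hz rij ij nij zij down.
by rewrite lt_len ltnNge ltnW.
Qed.

Lemma fpf_QP1 : QP1 gens (@fpf_conj n) (@fpf_height n).
Proof.
move=> r z /(reflection_exchanges n_gt1)[i [j [rij ij nij]]] e.
have [zi|zij] := eqVneq (z i) j; first exact: fpf_conj_fixed rij zi.
have [] := fpf_height_conj rij ij nij zij.
by rewrite e ltxx => <-.
Qed.

Lemma fpf_QP2 : QP2 gens (@fpf_conj n) (@fpf_height n).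
Proof.
move=> r z s /(reflection_exchanges n_gt1)[i [j [rij ij nij]]] gs up.
have [k sk] := gen_exchanges gs.
have [ers|nrs] := eqVneq r s; first by rewrite ers.
have hz := fpfP z; have zz m : z (z m) = m by case: (hz m).
(* Since [s r = (s r s^-1) s], the second inequality concerns the reflection [t_(s i)(s j)] acting
   on [s z s]. *)
rewrite -[(s * r)%g](mulgKV s) fpf_conjM => down.
have srij := exchanges_conj rij s.
(* Otherwise [s] would reverse [i < j] and equal [r]. *)
have sij : s i < s j.
  rewrite ltNge le_eqVlt; apply/norP; split.
    by apply/eqP => /aff_inj e; rewrite e ltxx in ij.
  apply/negP => /(gen_reverses n_gt1 gs ij)[sE _].
  by case/eqP: nrs; apply: exchanges_uniq rij sE.
have snij : (s i != s j %[mod n%:Z])%Z by rewrite aff_cong.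
have szs m : fpf_conj s z (s m) = s (z m) by rewrite /= aff_funK.
have zij : z i != j.
  by apply: contraTneq up => /(fpf_conj_fixed rij) ->; rewrite ltxx.
have szij : fpf_conj s z (s i) != s j by rewrite szs (inj_eq (@aff_inj _ s)).
move: down; rewrite (fpf_height_conj srij sij snij szij).2.
move: up; rewrite (fpf_height_conj rij ij nij zij).1.
rewrite /conj_raises !szs aff_cong; case: ifPn => [zi_j|nzij] lt_z.
  (* Linked case: both tests reduce to [l n < 0], so they cannot disagree. *)
  case/congP: zi_j lt_z => l ->; rewrite aff_shift.
  by rewrite !gtrDl => ->.
rewrite -leNgt le_eqVlt => /predU1P[/aff_inj/aff_inj e|lt_s].
  by rewrite e ltxx in ij.
have [sz _] := gen_reverses n_gt1 gs lt_z lt_s.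
have es : s = (fpf_val z * r * z)%g.
  have := exchanges_conj rij z; rewrite (invol_inv zz).
  exact: exchanges_uniq.
have zji : (z j != i %[mod n%:Z])%Z by rewrite -(aff_cong z) zz eq_sym.
(* [s] exchanges [z i] and [z j], both fixed by [r]. *)
have rs : (r * s * r = s)%g.
  have := exchanges_conj sz r; rewrite (exchanges_inv rij).
  rewrite !(exchanges_fix rij) ?fpf_ncong // => rsr.
  exact: exchanges_uniq rsr sz.
apply: fpfInv_ext; rewrite (fpf_conjE z rij) (fpf_conjE z sk).
have z2 : (fpf_val z * z = 1)%g by exact/affSym_ext/zz.
have sz_zr : (s * z = fpf_val z * r)%g by rewrite es -mulgA z2 mulg1.
have zs_rz : (fpf_val z * s = r * z)%g by rewrite es !mulgA z2 mul1g.
have rs_sr : (r * s = s * r)%g.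
  by rewrite -{2}rs -mulgA (exchanges_mulK rij) mulg1.
by rewrite -zs_rz sz_zr -!mulgA rs_sr.
Qed.

End Heights.

Theorem theorem4p8 (n : nat) (hn : (2 <= n)%N) (heven : ~~ odd n) :
  quasiparabolic (@simple_gens n) (@fpf_conj n) (@fpf_height n).
Proof.
split; [split | exact: fpf_QP1 | exact: fpf_QP2].
- by split=> [x|g h x]; [apply: fpf_conj1 | apply: fpf_conjM].
- by move=> x; apply: fpf_height_int.
by move=> s x; apply: fpf_height_conj_gen.
Qed.
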